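(* Let $M$ be an $n\times n$ complex matrix-valued function analytic in a neighbourhood of $0$ containing $\rho\bar{\mathbb{D}}$ for some $\rho>0$, with $M(0)$ invertible, and let $\mathbf{A}=\mathbf{e}_1\otimes\mathbf{N}+\mathbf{S}\otimes I$ be the associated infinite matrix (see context). Suppose $\mathbf{x}=\mathbf{e}_1\otimes x_1$ and $\tilde{\mathbf{y}}=\mathbf{N}^*\tilde y_1$, where $x_1,\tilde y_1\in\mathbb{C}^n$. (a) For any $k\in\mathbb{N}$, $$\mathbf{A}^k\mathbf{x}=\sum_{j=1}^{k+1}(\mathbf{e}_j\otimes z_{k-j+1}),$$ where $z_0=\tfrac1{k!}x_1$ and, for $i\in\{1,\dots,k\}$, $z_i$ is given by the recursion $$z_i=\sum_{\ell=1}^i\frac{(k-i+\ell)!}{(\ell-1)!\,(k-i)!}\,N_\ell\, z_{i-\ell}.$$ (b) For any $k\in\mathbb{N}$, $$(\mathbf{A}^* )^k\tilde{\mathbf{y}}=\sum_{j=1}^{k+1}(\mathbf{S}^T\otimes I)^{j-1}\mathbf{N}^*\tilde z_{k-j+1},$$ where $\tilde z_0=\tilde y_1$ and, for $i\in\{1,\dots,k\}$, $\tilde z_i$ is given by the recurrence relation $$\tilde z_i=\sum_{\ell=1}^i\frac{1}{(\ell-1)!}\,N_\ell^*\,\tilde z_{i-\ell}.$$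
   Context: $\mathbb{D}$ is the open unit disk in $\mathbb{C}$. Standing assumption: $M(0)^{-1}$ exists. $^*$ denotes conjugate transpose. For $j\ge1$ put $N_j=-\tfrac1j M(0)^{-1}M^{(j)}(0)\in\mathbb{C}^{n\times n}$ and $\mathbf{N}=[N_1\ N_2\ N_3\ \cdots]\in\mathbb{C}^{n\times\infty}$, so $\mathbf{N}^*$ has block rows $N_1^*,N_2^*,\dots$. $\mathbf{e}_k$ is the $k$-th unit vector of infinite length, $I$ is the $n\times n$ identity, and $\mathbf{S}$ is the infinite matrix with entries $1/j$ in position $(j+1,j)$, $j\ge1$, and zeros elsewhere. Vectors of infinite length are written in blocks $\mathbf{v}=[v_j]_{j=1}^\infty$ with $v_j\in\mathbb{C}^n$. The matrix $\mathbf{A}$ acts by: the first block of $\mathbf{A}\mathbf{v}$ is $\sum_{j=1}^\infty N_jv_j$ and the $(j+1)$-st block is $\tfrac1j v_j$, $j\ge1$. Its conjugate transpose $\mathbf{A}^*=\mathbf{e}_1^T\otimes\mathbf{N}^*+\mathbf{S}^T\otimes I$ acts by: the $k$-th block of $\mathbf{A}^*\mathbf{w}$ is $N_k^*w_1+\tfrac1k w_{k+1}$, $k\ge1$; and the $k$-th block of $(\mathbf{S}^T\otimes I)\mathbf{w}$ is $\tfrac1k w_{k+1}$. *)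

(* Defs.v *)
From HB Require Import structures.
From mathcomp Require Import all_boot all_order all_algebra.
From mathcomp Require Import complex.
From mathcomp Require Import boolp classical_sets functions reals.
From mathcomp Require Import topology normedtype sequences derive.
Set Implicit Arguments.
Unset Strict Implicit.
Unset Printing Implicit Defensive.
Import Order.TTheory GRing.Theory Num.Theory.
Import numFieldNormedType.Exports.

Local Open Scope classical_set_scope.
Local Open Scope ring_scope.
Local Open Scope sesquilinear_scope.

(* The complex numbers, packaged as a [numClosedFieldType] so that the normed
   space structure that MathComp-Analysis puts on every such type is found. *)
Definition Cplx (R : realType) : numClosedFieldType := R[i].

Definition analytic_at (K : numClosedFieldType) (V : normedModType K)
    (f : K -> V) (a : K) :=
  exists c : nat -> V,
    \forall z \near a, series (fun m => (z - a) ^+ m *: c m) @ \oo --> f z.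

Definition analytic_on (K : numClosedFieldType) (V : normedModType K)
    (U : set K) (f : K -> V) :=
  forall a, U a -> analytic_at f a.

Definition closed_disk (R : realType) (rho : R) : set (Cplx R) :=
  [set z : Cplx R | `|z| <= (rho%:C)%C].

(* Sequences are indexed by nat from 0: the entry (or block) in position p >= 1
   on paper is the one of index p.-1. *)

Section InfiniteMatrices.
Variables (K : numClosedFieldType) (n : nat).

(* Block vectors [v_j]_j, and infinite matrices with n x n blocks. *)
Definition bvec := nat -> 'cV[K]_n.
Definition bmx := nat -> nat -> 'M[K]_n.

Definition bctr (A : bmx) : bmx := fun i j => (A j i) ^t*.

Definition bmul_term (A : bmx) (v : bvec) (i : nat) : nat -> 'cV[K]_n :=
  fun j => A i j *m v j.

Definition bmul_defined (A : bmx) (v : bvec) :=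
  forall i, cvgn (series (bmul_term A v i)).

(* Meaningful when [bmul_defined A v]; for rows of A with finitely many nonzero
   blocks this is automatic, see [bmul_finite_row]. *)
Definition bmul (A : bmx) (v : bvec) : bvec :=
  fun i => limn (series (bmul_term A v i)).

Definition bpow (A : bmx) (k : nat) (v : bvec) : bvec := iter k (bmul A) v.

Definition bpow_defined (A : bmx) (k : nat) (v : bvec) :=
  forall m, (m < k)%N -> bmul_defined A (bpow A m v).

(* Action of an infinite block column (such as N^* ) on a vector of K^n. *)
Definition bcol_mul (B : nat -> 'M[K]_n) (y : 'cV[K]_n) : bvec :=
  fun i => B i *m y.

Definition unitv (p : nat) : nat -> K := fun i => (i.+1 == p)%:R.

Definition Smx : nat -> nat -> K :=
  fun i j => if i == j.+1 then (j.+1)%:R^-1 else 0.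

Definition Strmx : nat -> nat -> K := fun i j => Smx j i.

(* Kronecker products u (x) x, u (x) [B_1 B_2 ...] and T (x) B, for an infinite
   column u and an infinite matrix T of scalars. *)
Definition kron_vec (u : nat -> K) (x : 'cV[K]_n) : bvec := fun i => u i *: x.
Definition kron_row (u : nat -> K) (B : nat -> 'M[K]_n) : bmx :=
  fun i j => u i *: B j.
Definition kron_mx (T : nat -> nat -> K) (B : 'M[K]_n) : bmx :=
  fun i j => T i j *: B.

Lemma bmul_finite_row (A : bmx) (v : bvec) (i p : nat) :
  (forall j, (p <= j)%N -> A i j = 0) ->
  series (bmul_term A v i) @ \oo --> \sum_(j < p) A i j *m v j.
Proof.
move=> A0; apply: cvg_near_cst; exists p => //= m /= pm.
rewrite /series /= (@big_cat_nat _ _ _ p) //= big_mkord big_nat.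
rewrite [X in _ + X]big1 ?addr0 // => j /andP[pj _].
by rewrite /bmul_term A0 // mul0mx.
Qed.

Lemma bmul_row1 (A : bmx) (v : bvec) (i p : nat) :
  (forall j, j != p -> A i j = 0) -> bmul A v i = A i p *m v p.
Proof.
move=> A0; have Ap j : (p.+1 <= j)%N -> A i j = 0.
  by move=> pj; rewrite A0 // gtn_eqF.
rewrite /bmul (cvg_lim _ (bmul_finite_row Ap)) //.
rewrite big_ord_recr /= big1 ?add0r // => j _.
by rewrite A0 ?mul0mx // ltn_eqF.
Qed.

End InfiniteMatrices.

Section AssociatedMatrix.
Variables (K : numClosedFieldType) (n : nat) (M : K -> 'M[K]_n).

Definition Ncoef (j : nat) : 'M[K]_n :=
  - (j%:R^-1 *: (invmx (M 0) *m derive1n j M 0)).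

Definition Nrow : nat -> 'M[K]_n := fun j => Ncoef j.+1.

Definition Nctr : nat -> 'M[K]_n := fun j => (Nrow j) ^t*.

Definition Amx : bmx K n :=
  fun i j => kron_row (unitv K 1) Nrow i j + kron_mx (@Smx K) 1%:M i j.

Lemma bmul_Amx0 (v : bvec K n) :
  bmul Amx v 0%N = limn (series (fun j => Nrow j *m v j)).
Proof.
rewrite /bmul; congr (limn (series _)); apply/funext => j.
by rewrite /bmul_term /Amx /kron_row /kron_mx /unitv /Smx /= scale1r scale0r addr0.
Qed.

Lemma bmul_AmxS (v : bvec K n) (j : nat) :
  bmul Amx v j.+1 = (j.+1)%:R^-1 *: v j.
Proof.
rewrite (@bmul_row1 _ _ _ _ _ j) => [|i ij].
  rewrite /Amx /kron_row /kron_mx /unitv /Smx eqxx scale0r add0r.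
  by rewrite -scalemxAl mul1mx.
rewrite /Amx /kron_row /kron_mx /unitv /Smx scale0r add0r eqSS eq_sym.
by rewrite (negbTE ij) scale0r.
Qed.

Lemma bmul_bctr_Amx (w : bvec K n) (k : nat) :
  bmul (bctr Amx) w k = Nctr k *m w 0%N + (k.+1)%:R^-1 *: w k.+1.
Proof.
have B0 j : (k.+2 <= j)%N -> bctr Amx k j = 0.
  case: j => // j kj; rewrite /bctr /Amx /kron_row /kron_mx /unitv /Smx.
  by rewrite eqSS (gtn_eqF kj) !scale0r addr0 trmx0 map_mx0.
rewrite /bmul (cvg_lim _ (bmul_finite_row B0)) //.
rewrite big_ord_recr big_ord_recl /= big1 ?addr0 => [|j _].
  rewrite /bctr /Amx /kron_row /kron_mx /unitv /Smx /= eqxx.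
  rewrite scale1r !scale0r addr0 add0r; congr (_ + _).
  by rewrite linearZ /= trmx1 map_mxZ map_mx1 fmorphV rmorph_nat -scalemxAl mul1mx.
rewrite /bctr /Amx /kron_row /kron_mx /unitv /Smx /= /bump /=.
by rewrite !eqSS ltn_eqF ?ltn_ord // !scale0r addr0 trmx0 map_mx0 mul0mx.
Qed.

End AssociatedMatrix.

Lemma bmul_Strmx (K : numClosedFieldType) (n : nat) (w : bvec K n) (k : nat) :
  bmul (kron_mx (@Strmx K) 1%:M) w k = (k.+1)%:R^-1 *: w k.+1.
Proof.
rewrite (@bmul_row1 _ _ _ _ _ k.+1) => [|i ik]; rewrite /kron_mx /Strmx /Smx.
  by rewrite eqxx -scalemxAl mul1mx.
by rewrite (negbTE ik) scale0r.
Qed.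

(* Main.v *)
Require Import Defs.
From HB Require Import structures.
From mathcomp Require Import all_boot all_order all_algebra.
From mathcomp Require Import complex.
From mathcomp Require Import boolp classical_sets functions reals.
From mathcomp Require Import topology normedtype sequences derive.
Import Order.TTheory GRing.Theory Num.Theory.
Import numFieldNormedType.Exports.

Local Open Scope classical_set_scope.
Local Open Scope ring_scope.
Local Open Scope sesquilinear_scope.

(** Both parts are read off from the first blocks of the iterates.  A vector is
    moved by [Amx M] down one block (with weights [1/j]) while a new first block
    is created from the row of the [N_j].  Hence, if [a m] is the first block
    of the [m]-th iterate of [e_1 (x) x1], the block of index [i] of that iterate
    is [a (m - i) / i!], and the new first block turns this into the recurrence
    [a (m+1) = \sum_l (1/l!) N_(l+1) a (m - l)].  The vectors [z_i] of part (a)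
    are the rescalings [a i / (k - i)!]; multiplying by [(k - i)!] removes the
    dependence on [k], which makes an induction on the number of iterations
    possible.  These iterates have finite support, so the series in [Amx M] are
    eventually constant.

    Dually, the adjoint sends [w] to [N^* w_1 + (S^T (x) I) w].  Applied to
    [\sum_j (S^T (x) I)^j N^* z_(k-j)], the second summand raises the exponents
    and the first adds the term of exponent zero, namely [N^*] times the first
    block of the sum.  As the first block of [(S^T (x) I)^j w] is [w_j / j!],
    that block is the same convolution as before, with [N_l^*] in place of
    [N_l], and so it is the next [z].  The two parts thus share one recurrence,
    [factorial_convolution]. *)

Section Recurrence.
Set Implicit Arguments.
Unset Strict Implicit.
Variables (K : numClosedFieldType) (n : nat).

(** The recurrence shared by both parts, with [B] the sequence of the [N_j] or of
    the [N_j^*], shifted to start at index 0.  It is imposed up to index [k]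
    only, since the vectors [z_i] of the theorem are constrained no further. *)
Definition factorial_convolution (B : nat -> 'M[K]_n) (k : nat)
    (a : nat -> 'cV[K]_n) :=
  forall i, (i < k)%N ->
    a i.+1 = \sum_(l < i.+1) (l`!%:R)^-1 *: (B l *m a (i - l)%N).

Lemma bmul_finite_support (A : bmx K n) (v : bvec K n) (i p : nat) :
  (forall j, (p <= j)%N -> v j = 0) ->
  series (bmul_term A v i) @ \oo --> \sum_(j < p) A i j *m v j.
Proof.
move=> v0; apply: cvg_near_cst; exists p => //= m /= pm.
rewrite /series /= (@big_cat_nat _ _ _ p) //= big_mkord big_nat.
rewrite [X in _ + X]big1 ?addr0 // => j /andP[pj _].
by rewrite /bmul_term v0 // mulmx0.
Qed.

End Recurrence.

Section Iterates.
Set Implicit Arguments.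
Unset Strict Implicit.
Variables (K : numClosedFieldType) (n : nat) (M : K -> 'M[K]_n).

(** The block of index [i] has been created [i] steps before step [m], with value
    [a (m - i)], and has since been shifted with the weights [1, 1/2, .., 1/i]. *)
Lemma bpow_AmxE (k : nat) (a : nat -> 'cV[K]_n) :
  factorial_convolution (Nrow M) k a ->
  forall m, (m <= k)%N -> forall i,
    bpow (Amx M) m (kron_vec (unitv K 1) (a 0%N)) i =
      if (i <= m)%N then (i`!%:R)^-1 *: a (m - i)%N else 0.
Proof.
move=> arec; elim=> [_ [|i]|m IHm mk [|i]].
- by rewrite /= /kron_vec /unitv invr1.
- by rewrite /= /kron_vec /unitv scale0r.
- have supp j : (m.+1 <= j)%N ->
      bpow (Amx M) m (kron_vec (unitv K 1) (a 0%N)) j = 0.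
    by move=> mj; rewrite IHm ?(ltnW mk) // leqNgt mj.
  rewrite /bpow iterS -/(bpow _ _ _) /bmul.
  rewrite (cvg_lim _ (bmul_finite_support supp)) //.
  rewrite invr1 scale1r subn0 arec //; apply: eq_bigr => l _.
  rewrite IHm ?(ltnW mk) // -ltnS ltn_ord -scalemxAr; congr (_ *: (_ *m _)).
  rewrite /Amx /kron_row /kron_mx /unitv /Smx.
  by rewrite scale1r scale0r addr0.
rewrite /bpow iterS bmul_AmxS -/(bpow _ _ _) IHm ?(ltnW mk) // ltnS subSS.
case: ifP => _; last by rewrite scaler0.
by rewrite scalerA factS natrM invfM.
Qed.

Lemma bpow_Amx_defined (k : nat) (a : nat -> 'cV[K]_n) :
  factorial_convolution (Nrow M) k a ->
  bpow_defined (Amx M) k (kron_vec (unitv K 1) (a 0%N)).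
Proof.
move=> arec m mk i; apply/cvg_ex; eexists.
apply: (@bmul_finite_support _ _ _ _ i m.+1) => j mj.
by rewrite (bpow_AmxE arec) ?(ltnW mk) // leqNgt mj.
Qed.

Lemma bmul_bctr_Amx_split (w : bvec K n) :
  bmul (bctr (Amx M)) w =
    bcol_mul (Nctr M) (w 0%N) + bmul (kron_mx (@Strmx K) 1%:M) w.
Proof.
by apply/funext => i; rewrite bmul_bctr_Amx addrfctE bmul_Strmx.
Qed.

Lemma bmul_Strmx_sum (I : Type) (r : seq I) (w : I -> bvec K n) :
  bmul (kron_mx (@Strmx K) 1%:M) (\sum_(j <- r) w j) =
    \sum_(j <- r) bmul (kron_mx (@Strmx K) 1%:M) (w j).
Proof.
apply/funext => i; rewrite bmul_Strmx !fct_sumE scaler_sumr.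
by apply: eq_bigr => j _; rewrite bmul_Strmx.
Qed.

Lemma bpow_Strmx0 (m : nat) (w : bvec K n) :
  bpow (kron_mx (@Strmx K) 1%:M) m w 0%N = (m`!%:R)^-1 *: w m.
Proof.
elim: m w => [|m IHm] w; first by rewrite invr1 scale1r.
rewrite /bpow iterSr -/(bpow _ _ _) IHm bmul_Strmx scalerA.
by rewrite factS natrM invfM mulrC.
Qed.

(** By induction on [k]: the block of index 0 of the right-hand side is the
    convolution that defines [z k.+1], so that the adjoint adds the term of
    exponent zero for the next iterate. *)
Lemma bpow_bctr_AmxE (k : nat) (z : nat -> 'cV[K]_n) :
  factorial_convolution (Nctr M) k z ->
  bpow (bctr (Amx M)) k (bcol_mul (Nctr M) (z 0%N)) =
    \sum_(0 <= j < k.+1)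
      bpow (kron_mx (@Strmx K) 1%:M) j (bcol_mul (Nctr M) (z (k - j)%N)).
Proof.
elim: k => [|k IHk] zrec; first by rewrite big_nat1.
rewrite /bpow iterS -/(bpow _ _ _) IHk => [|i ik]; last exact/zrec/ltnW.
rewrite bmul_bctr_Amx_split bmul_Strmx_sum [RHS]big_nat_recl //.
congr (bcol_mul _ _ + _).
rewrite fct_sumE subn0 zrec // big_mkord; apply: eq_bigr => j _.
by rewrite bpow_Strmx0.
Qed.

End Iterates.

Theorem proposition3p1 (R : realType) (n : nat)
    (M : Cplx R -> 'M[Cplx R]_n) (U : set (Cplx R)) (rho : R)
    (openU : open U) (rho_gt0 : 0 < rho) (diskU : closed_disk rho `<=` U)
    (M_analytic : analytic_on U M) (M0_unit : M 0 \in unitmx)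
    (x1 y1 : 'cV[Cplx R]_n) :
  (forall (k : nat) (z : nat -> 'cV[Cplx R]_n),
      z 0%N = (k`!%:R)^-1 *: x1 ->
      (forall i, (1 <= i <= k)%N ->
         z i = \sum_(1 <= l < i.+1)
                 (((k - i + l)`!)%:R / ((l - 1)`! * (k - i)`!)%:R)
                   *: (Ncoef M l *m z (i - l)%N)) ->
      bpow_defined (Amx M) k (kron_vec (unitv _ 1) x1) /\
      bpow (Amx M) k (kron_vec (unitv _ 1) x1) =
        \sum_(1 <= j < k.+2) kron_vec (unitv _ j) (z (k + 1 - j)%N)) /\
  (forall (k : nat) (z : nat -> 'cV[Cplx R]_n),
      z 0%N = y1 ->
      (forall i, (1 <= i <= k)%N ->
         z i = \sum_(1 <= l < i.+1)
                 ((l - 1)`!%:R)^-1 *: ((Ncoef M l) ^t* *m z (i - l)%N)) ->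
      bpow (bctr (Amx M)) k (bcol_mul (Nctr M) y1) =
        \sum_(1 <= j < k.+2)
          bpow (kron_mx (@Strmx _) 1%:M) (j - 1)
               (bcol_mul (Nctr M) (z (k + 1 - j)%N))).
Proof.
split=> k z z0 zrec.
  pose a i := (k - i)`!%:R *: z i.
  have fact_neq0 m : (m`!%:R : Cplx R) != 0 by rewrite pnatr_eq0 -lt0n fact_gt0.
  have a0 : a 0%N = x1 by rewrite /a subn0 z0 scalerA divff ?scale1r.
  have arec : factorial_convolution (Nrow M) k a.
    move=> i ik; rewrite /a zrec // big_add1 big_mkord scaler_sumr.
    apply: eq_bigr => -[l /= lti] _; rewrite -scalemxAr !scalerA subn1 subSS /=.
    congr (_ *: _); rewrite (_ : (k - i.+1 + l.+1 = k - (i - l))%N); last first.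
      by rewrite addnS -addSn subnSK // subnBA // addnBAC // ltnW.
    by rewrite natrM invfM mulrCA [X in _ * X]mulrCA mulfV // mulr1 mulrC.
  rewrite -a0; split; first exact: bpow_Amx_defined arec.
  apply/funext => i; rewrite (bpow_AmxE arec) // fct_sumE big_add1 /=.
  under eq_bigr do rewrite addn1 subSS /kron_vec /unitv eqSS.
  case: ifPn => [ik|]; last first.
    rewrite -ltnNge big_nat => ki; rewrite big1 // => j /andP[_ jk].
    by rewrite gtn_eqF ?scale0r // (leq_trans jk).
  rewrite big_mkord (bigD1 (Ordinal (ik : (i < k.+1)%N))) //= eqxx scale1r.
  rewrite big1 ?addr0 => [|j /negP ji].
    by rewrite /a subKn // scalerA mulVf // scale1r.
  by case: eqP => [ij|]; [case: ji; apply/eqP/val_inj | rewrite scale0r].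
rewrite -z0 bpow_bctr_AmxE => [|i ik].
  by rewrite [RHS]big_add1; apply: eq_bigr => j _; rewrite addn1 !subSS subn0.
rewrite zrec // big_add1 big_mkord; apply: eq_bigr => l _.
by rewrite subn1 subSS.
Qed.
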